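(* Let $X,Y$ be real topological-linear spaces, $\Omega\subseteq X$ nonempty, $f:X\to Y$. Suppose that $K\subseteq Y$ is a convex cone, and take sets $\mathcal P\subseteq Y$, $\mathcal T\subseteq \operatorname{int}K$ and $\mathcal R\subseteq\mathbb R$ such that $f[\mathrm{WEff}(\Omega\mid f,K)]\subseteq \mathcal P+\mathcal R\cdot\mathcal T$. Then, for any $\bar x\in\Omega$, the following assertions are equivalent: (1°) $\bar x\in \mathrm{WEff}(\Omega\mid f,K)$. (2°) There are some $a\in\mathcal P$, $k\in\mathcal T$ and $s\in\mathcal R$ so that $(\bar x,s)$ is a solution of the problem $\mathrm{PS}(a,k)$: minimize $\lambda$ subject to $f(x)\in\lambda k+(a-K)$, $(x,\lambda)\in\Omega\times\mathbb R$. If, in addition, $K$ is closed and nontrivial, then (1°) and (2°) are equivalent to: (3°) There are some $a\in\mathcal P$, $k\in\mathcal T$ and $s\in\mathcal R$ so that $s=\varphi^G_{a-K,k}(f(\bar x))=\min_{x\in\Omega}\varphi^G_{a-K,k}(f(x))$.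
   Context: A set $K\subseteq Y$ is a cone if $0\in K=\mathbb R_+\cdot K$, where $\mathbb R_+=[0,\infty)$; it is nontrivial if $\{0\}\neq K\neq Y$. $f[D]$ denotes the image of $D$ under $f$. $\mathrm{WEff}(\Omega\mid f,K)$ is the set of all $\bar x\in\Omega$ for which there is no $x\in\Omega$ with $f(x)\in f(\bar x)-\operatorname{int}K$ (weakly efficient solutions). A solution of $\mathrm{PS}(a,k)$ is a feasible pair $(x,\lambda)$ whose $\lambda$ is minimal among all feasible pairs. $\varphi^G_{a-K,k}(y):=\inf\{t\in\mathbb R\mid y\in tk+(a-K)\}\in\mathbb R\cup\{-\infty,+\infty\}$ for $y\in Y$ (Gerstewitz function; $\inf\emptyset=+\infty$). *)

(* Defs.v *)
From mathcomp Require Export all_boot all_order all_algebra.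
From mathcomp Require Export all_classical all_reals all_analysis.

Set Implicit Arguments.
Unset Strict Implicit.
Unset Printing Implicit Defensive.

Export Order.TTheory GRing.Theory Num.Theory.
Export numFieldNormedType.Exports.

Local Open Scope classical_set_scope.
Local Open Scope ring_scope.

(* Real topological-linear spaces are rendered by topologicalLmodType over a
   realType rather than tvsType, which would impose local convexity. No
   separation axiom is assumed. *)

Definition is_cone (R : realType) (Y : lmodType R) (K : set Y) : Prop :=
  K 0 /\ K = [set t *: y | t in [set t : R | 0 <= t] & y in K].

Definition nontrivial (R : realType) (Y : lmodType R) (K : set Y) : Prop :=
  [set 0] <> K /\ K <> setT.

Definition subtract_set (Y : zmodType) (b : Y) (A : set Y) : set Y :=
  [set b - y | y in A].

Definition translate (Y : zmodType) (b : Y) (A : set Y) : set Y :=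
  [set b + y | y in A].

Definition WEff (R : realType) (X Y : topologicalLmodType R) (Omega : set X)
    (f : X -> Y) (K : set Y) : set X :=
  [set xbar | Omega xbar /\
    ~ exists x, Omega x /\ subtract_set (f xbar) K° (f x)].

Definition PS_feasible (R : realType) (X Y : topologicalLmodType R)
    (Omega : set X) (f : X -> Y) (K : set Y) (a k : Y) : set (X * R) :=
  [set p | Omega p.1 /\ translate (p.2 *: k) (subtract_set a K) (f p.1)].

Definition PS_solution (R : realType) (X Y : topologicalLmodType R)
    (Omega : set X) (f : X -> Y) (K : set Y) (a k : Y) : set (X * R) :=
  [set p | PS_feasible Omega f K a k p /\
    forall q, PS_feasible Omega f K a k q -> p.2 <= q.2].

(* Valued in \bar R, with value +oo when no t is admissible. *)
Definition gerstewitz (R : realType) (Y : lmodType R) (A : set Y) (k y : Y)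
    : \bar R :=
  ereal_inf [set t%:E | t in [set t : R | translate (t *: k) A y]].

Definition is_min (R : realType) (S : set (\bar R)) (m : \bar R) : Prop :=
  S m /\ lbound S m.

(* Main.v *)
(* If xbar is weakly efficient, write f xbar = a + s k.  A feasible pair (x, t)
   with t < s would give f xbar - f x = (s - t) k + w with w in K, which lies in
   int K.  Conversely, if f xbar - f x lies in int K, then x remains feasible
   with the parameter s - e for a small e > 0, so s is not minimal.  Finally, a
   minimal feasible parameter is the minimum of the Gerstewitz values, and
   closedness of K makes a finite Gerstewitz infimum attained, hence feasible.
*)

Require Import Defs.
From mathcomp Require Import lra.

Local Open Scope classical_set_scope.
Local Open Scope ring_scope.

(** Feasibility becomes membership of a single slack vector in [K], the form to which cone
    arithmetic and continuity apply. *)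
Lemma translate_subtractE (Y : zmodType) (K : set Y) (a v y : Y) :
  translate v (subtract_set a K) y <-> K (v + a - y).
Proof.
split=> [[_ [w Kw <-] <-]|Kw]; first by rewrite opprD addrACA subrr add0r subKr.
exists (a - (v + a - y)); first by exists (v + a - y).
by rewrite addrA subKr.
Qed.

Lemma coneZ (R : realType) (Y : lmodType R) (K : set Y) (t : R) (y : Y) :
  is_cone K -> 0 <= t -> K y -> K (t *: y).
Proof. by move=> [_ KE] t0 Ky; rewrite KE; exists t => //; exists y. Qed.

(** The midpoint lies in [K] by convexity, and doubling it stays in the cone. *)
Lemma convex_coneD (R : realType) (Y : lmodType R) (K : set Y) (x y : Y) :
  is_cone K -> convex_set K -> K x -> K y -> K (x + y).
Proof.
move=> Kcone Kconvex Kx Ky.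
have half_ge0 : 0 <= 2^-1 :> R by lra.
have half_le1 : 2^-1 <= 1 :> R by lra.
have Kmid : K (2^-1 *: (x + y)).
  have /set_mem : 2^-1 *: x + (1 - 2^-1) *: y \in K := Kconvex x y (Itv01 half_ge0 half_le1)
    (mem_set Kx) (mem_set Ky).
  have -> : 1 - 2^-1 = 2^-1 :> R by lra.
  by rewrite scalerDr.
rewrite -[x + y]scale1r -(@divff _ (2 : R)) ?pnatr_eq0// -scalerA.
exact: coneZ.
Qed.

Lemma affine_scalar_continuous (R : realType) (Y : topologicalLmodType R)
    (u v : Y) :
  continuous (fun t : R => u + t *: v).
Proof.
move=> t; apply: (@continuous2_cvg _ Y Y Y _ _ (fun=> u) (fun t => t *: v) +%R).
- exact: (@add_continuous Y (u, t *: v)).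
- exact: cvg_cst.
apply: (@continuous2_cvg _ R^o Y Y _ _ (fun t => t) (fun=> v) *:%R).
- exact: (@scale_continuous R Y (t, v)).
- exact: cvg_id.
- exact: cvg_cst.
Qed.

Lemma translate_scale_continuous (R : realType) (Y : topologicalLmodType R)
    (c : R) (w : Y) :
  continuous (fun z : Y => c *: (z - w)).
Proof.
move=> z; apply: (@continuous2_cvg _ R^o Y Y _ _ (fun=> c) (fun z => z - w) *:%R).
- exact: (@scale_continuous R Y (c, z - w)).
- exact: cvg_cst.
apply: (@continuous2_cvg _ Y Y Y _ _ (fun z => z) (fun=> - w) +%R).
- exact: (@add_continuous Y (z, - w)).
- exact: cvg_id.
- exact: cvg_cst.
Qed.

(** The continuous map [z |-> c^-1 *: (z - w)] sends [c *: u + w] to [u], so it maps a whole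
    neighbourhood of that point into [K]; undoing the map by scaling with [c] and adding [w] stays
    in [K]. *)
Lemma interior_convex_coneD (R : realType) (Y : topologicalLmodType R)
    (K : set Y) (c : R) (u w : Y) :
  is_cone K -> convex_set K -> 0 < c -> K° u -> K w -> K° (c *: u + w).
Proof.
move=> Kcone Kconvex c0 Ku Kw.
have : nbhs (c *: u + w) ((fun z : Y => c^-1 *: (z - w)) @^-1` K).
  apply: (@translate_scale_continuous R Y).
  by rewrite addrK scalerA mulVf ?gt_eqF// scale1r.
apply: filterS => z /= Kz; rewrite -(subrK w z).
apply: convex_coneD => //.
rewrite -[z - w]scale1r -(divff (lt0r_neq0 c0)) -scalerA.
by apply: coneZ => //; exact: ltW.
Qed.

Lemma interior_subZ (R : realType) (Y : topologicalLmodType R)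
    (K : set Y) (y k : Y) :
  K° y -> exists2 e : R, 0 < e & K (y - e *: k).
Proof.
move=> Ky.
have : nbhs (0 : R) ((fun t : R => y + t *: - k) @^-1` K).
  by apply: (@affine_scalar_continuous R Y); rewrite scale0r addr0.
move=> /nbhs_ballP [e /= e0 eK].
(* The ball around 0 is open, so [e] itself may fall outside; half of it does not. *)
exists (e / 2); first exact: divr_gt0.
rewrite -scalerN; apply: eK.
by rewrite /ball /= sub0r normrN gtr0_norm ?divr_gt0// ltr_pdivrMr// ltr_pMr// ltr1n.
Qed.

(** If [s] were not admissible, openness of the complement of [K] would exclude every parameter
    within some [e] of [s], yet an infimum equal to [s] forces an admissible one in [[s, s + e)]. *)
Lemma gerstewitz_attained (R : realType) (Y : topologicalLmodType R)
    (K : set Y) (a k y : Y) (s : R) :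
  closed K -> gerstewitz (subtract_set a K) k y = s%:E ->
  translate (s *: k) (subtract_set a K) y.
Proof.
move=> Kclosed sE; apply/translate_subtractE; apply: contrapT => nKs.
have : nbhs (a - y + s *: k) (~` K).
  by apply: open_nbhs_nbhs; split; [exact: closed_openC|rewrite addrC addrA].
move/(@affine_scalar_continuous R Y (a - y) k s)/nbhs_ballP => [e /= e0 eK].
have [|_ [t tfeas <-]] := @ereal_inf_lt R
    [set t%:E | t in [set t : R | translate (t *: k) (subtract_set a K) y]]
    (s + e)%:E.
  by rewrite -/(gerstewitz _ _ _) sE lte_fin ltrDl.
rewrite lte_fin => tse.
have st : s <= t by rewrite -lee_fin -sE; apply: ereal_inf_lbound; exists t.
apply: (eK t); first by rewrite /ball /= distrC ger0_norm ?subr_ge0// ltrBlDl.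
by move/translate_subtractE: tfeas; rewrite -addrA addrC.
Qed.

Theorem proposition10 (R : realType) (X Y : topologicalLmodType R)
    (Omega : set X) (hOmega : Omega !=set0) (f : X -> Y)
    (K : set Y) (hKcone : is_cone K) (hKconvex : convex_set K)
    (P T : set Y) (RR : set R) (hT : T `<=` K°)
    (hcover : f @` WEff Omega f K `<=`
       [set p + v | p in P & v in [set r *: t | r in RR & t in T]])
    (xbar : X) (hxbar : Omega xbar) :
  let assertion1 := WEff Omega f K xbar in
  let assertion2 := exists a k s, [/\ P a, T k, RR s &
    PS_solution Omega f K a k (xbar, s)] in
  let assertion3 := exists a k s, [/\ P a, T k, RR s &
    s%:E = gerstewitz (subtract_set a K) k (f xbar) /\
    is_min [set gerstewitz (subtract_set a K) k (f x) | x in Omega] s%:E] in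
  (assertion1 <-> assertion2) /\
  (closed K -> nontrivial K ->
    (assertion1 <-> assertion3) /\ (assertion2 <-> assertion3)).
Proof.
move=> A1 A2 A3.
have A12 : A1 <-> A2.
  split=> [eff|[a [k [s [_ Tk _ [[_ /translate_subtractE Kxbar] smin]]]]]].
    have [a Pa [_ [s Rs [k Tk <-]] fxE]] := hcover _ (ex_intro2 _ _ _ eff erefl).
    exists a, k, s; split=> //; split.
      (* Here the slack is exactly 0, which belongs to the cone. *)
      by split=> //; apply/translate_subtractE; rewrite -fxE (addrC a) subrr; case: hKcone.
    move=> [x t] /= [Ox /translate_subtractE /= Kx]; rewrite leNgt; apply/negP => ts.
    case: eff => _; apply; exists x; split=> //.
    (* Since [f xbar = a + s *: k], this sum equals [f xbar - f x]; its second term is the slack of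
       [(x, t)]. *)
    exists ((s - t) *: k + (t *: k + a - f x)).
      by apply: interior_convex_coneD => //; [rewrite subr_gt0|exact: hT].
    by rewrite -fxE scalerBl !addrA subrK (addrC a) subKr.
  split=> //; move=> [x [Ox [y Ky fxE]]].
  (* With [y = f xbar - f x] interior, adding the slack of [(xbar, s)] gives the slack of [(x, s)],
     again interior, which leaves room to move by [- e *: k]. *)
  have [e e0 Ke] : exists2 e : R, 0 < e &
      K (y + (s *: k + a - f xbar) - e *: k).
    apply: interior_subZ; rewrite -[y]scale1r.
    exact: interior_convex_coneD.
  suff /smin /= : PS_feasible Omega f K a k (x, s - e).
    by rewrite lerDl oppr_ge0 leNgt e0.
  split=> //=; apply/translate_subtractE.
  rewrite -fxE scalerBl opprB [_ - e *: k + a]addrAC [_ - e *: k + _]addrAC.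
  by rewrite [_ + (y - _)]addrCA.
split=> // Kclosed _.
suff A23 : A2 <-> A3 by split=> //; apply: iff_trans A12 A23.
split=> -[a [k [s [Pa Tk Rs]]]].
  move=> [[_ xbarfeas] smin].
  (* Minimality of [s] ranges over all feasible pairs, so it bounds the admissible parameters of
     each [x] separately; with none, the value is [+oo]. *)
  have slb x : Omega x -> (s%:E <= gerstewitz (subtract_set a K) k (f x))%E.
    move=> Ox; apply: le_ereal_inf_tmp => _ [t tfeas <-].
    by rewrite lee_fin; exact: (smin (x, t)).
  have sE : s%:E = gerstewitz (subtract_set a K) k (f xbar).
    apply/eqP; rewrite eq_le slb//=.
    by apply: ereal_inf_lbound; exists s.
  exists a, k, s; split=> //; split=> //; split; first by exists xbar.
  by move=> _ [x Ox <-]; exact: slb.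
move=> [sE [_ slb]].
exists a, k, s; split=> //; split.
  by split=> //; exact: gerstewitz_attained.
(* The Gerstewitz value at [f x] lies between [s] and any admissible [t]. *)
move=> [x t] [/= Ox tfeas]; rewrite -lee_fin.
apply: le_trans (slb _ (ex_intro2 _ _ _ Ox erefl)) _.
by apply: ereal_inf_lbound; exists t.
Qed.
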